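(* Let $G=\varpi/\pi$ with $\varpi=\Gamma^2(1/4)/(2\sqrt{2\pi})$. Each of the following six sequences is a probability mass function on the indicated index set (that is, its terms are nonnegative and sum to $1$): \begin{align*} (p_n)_{n\in\mathbb{N}_0}&:\quad p_n=\frac{2}{\sqrt{2}\,G+1}\operatorname{sech}(\pi n),\\ (q_k)_{k\in\mathbb{Z}}&:\quad q_k=\frac{1}{\sqrt{2}\,G}\operatorname{sech}(\pi k),\\ (r_n)_{n\in\mathbb{N}_0}&:\quad r_n=\frac{2}{G}\operatorname{sech}\left(\frac{\pi}{2}(2n+1)\right),\\ (s_k)_{k\in\mathbb{Z}}&:\quad s_k=\frac{1}{G}\operatorname{sech}\left(\frac{\pi}{2}(2k+1)\right),\\ (t_n)_{n\in\mathbb{N}_0}&:\quad t_n=\frac{2}{(1+\sqrt{2})G+1}\operatorname{sech}\left(\frac{\pi}{2}n\right),\\ (u_k)_{k\in\mathbb{Z}}&:\quad u_k=\frac{1}{(1+\sqrt{2})G}\operatorname{sech}\left(\frac{\pi}{2}k\right). \end{align*}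
   Context: $\operatorname{sech}(x)=1/\cosh(x)$, $\mathbb{N}_0=\{0,1,2,\dots\}$. $\varpi=\Gamma^2(1/4)/(2\sqrt{2\pi})$ is the lemniscate constant and $G=\varpi/\pi$ is Gauss' constant ($G\approx 0.8346$). *)

(* Defs.v *)
From mathcomp Require Import all_boot all_order all_algebra.
From mathcomp Require Import all_classical all_reals all_analysis.

Set Implicit Arguments.
Unset Strict Implicit.
Unset Printing Implicit Defensive.

Import Order.TTheory GRing.Theory Num.Theory.
Import numFieldNormedType.Exports.

Local Open Scope classical_set_scope.
Local Open Scope ring_scope.

Definition cosh (R : realType) (x : R) : R := (expR x + expR (- x)) / 2.

Definition sech (R : realType) (x : R) : R := 1 / cosh x.

(* Euler's integral. It represents the Gamma function for 0 < s only: [Rintegral]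
   returns 0 when the integral diverges. *)
Definition Gamma (R : realType) (s : R) : R :=
  \int[lebesgue_measure]_(t in `]0, +oo[) (t `^ (s - 1) * expR (- t)).

Definition lemniscate (R : realType) : R :=
  Gamma (1 / 4) ^+ 2 / (2 * Num.sqrt (2 * pi)).

Definition gauss (R : realType) : R := lemniscate R / pi.

(* [esum] is the unordered sum in \bar R (the supremum of the finite partial
   sums), which is the sum of the family since all its terms are nonnegative. *)
Definition is_pmf (R : realType) (I : countType) (p : I -> R) : Prop :=
  (forall i, 0 <= p i) /\ (\esum_(i in [set: I]) (p i)%:E = 1)%E.

(* Main.v *)
(* Write A(h) for the sum of sech(h k) over the integers k. Since
   sech x sech y = 2 / (cosh(x+y) + cosh(x-y)), and since for fixed y the series
   of 1 / (cosh x + cosh y) in x telescopes, one gets the duplication formula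
     (A(h/2) - A(h))^2 = 4 A(2h) (A(h) - A(2h)).
   It says that (A(2^n h), 2 A(2^(n+1) h) - A(2^n h)) and
   (A(h/2^n), A(h/2^(n+1)) - A(h/2^n)) / 2^n are arithmetic-geometric mean
   iterations; their limits are 1 and pi/h. At h = pi the limits and the first
   terms agree, hence so do the second terms, and A(pi) is sqrt 2 times the sum
   A(pi/2) - A(pi) over half-integers. Gauss's integral for the
   arithmetic-geometric mean then gives
   pi A(pi) = 2 int_0^oo du / sqrt(1 + u^4), and the right-hand side is
   Gamma(1/4)^2 / (2 sqrt pi) by Tonelli's theorem and the Gaussian integral. *)
Require Import Defs.
From mathcomp Require Import all_boot all_order all_algebra.
From mathcomp Require Import all_classical all_reals all_analysis.
From mathcomp Require Import measurable_realfun zify ring lra.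

Import Order.TTheory GRing.Theory Num.Theory.
Import numFieldNormedType.Exports.

Local Open Scope classical_set_scope.
Local Open Scope ring_scope.

(** * Unordered sums of nonnegative families: scaling, splitting, products, telescoping *)

Lemma esumZl (R : realType) (T : choiceType) (D : set T) (f : T -> \bar R) (c : R) :
  0 < c -> (forall i, 0 <= f i)%E ->
  (\esum_(i in D) (c%:E * f i) = c%:E * \esum_(i in D) f i)%E.
Proof.
move=> c0 f0.
have le_esumZ (d : R) (g : T -> \bar R) : 0 < d -> (forall i, 0 <= g i)%E ->
    (\esum_(i in D) (d%:E * g i) <= d%:E * \esum_(i in D) g i)%E.
  move=> d0 g0; apply: ge_ereal_sup => _ [X [finX XD] <-].
  rewrite fsbig_finite//= -ge0_sume_distrr//.
  apply: lee_wpmul2l; first by rewrite lee_fin ltW.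
  by apply: ereal_sup_ubound; exists X => //; rewrite fsbig_finite.
(* The reverse inequality is [le_esumZ] for the factor [c^-1] and the family [c * f i]. *)
apply/eqP; rewrite eq_le le_esumZ//=.
rewrite -lee_pdivlMl//.
apply: le_trans (le_esumZ c^-1 (fun i => c%:E * f i)%E _ _).
- apply: le_esum => i _.
  by rewrite muleA -EFinM mulVf ?gt_eqF// mul1e.
- by rewrite invr_gt0.
- by move=> i; rewrite mule_ge0// lee_fin ltW.
Qed.

Section esum_int.
Context {R : realType}.
Local Open Scope ereal_scope.

Lemma esum_int_nat (f : int -> \bar R) : (forall k, 0 <= f k) ->
  \esum_(k in [set: int]) f k =
  \esum_(n in [set: nat]) f n%:Z + \esum_(n in [set: nat]) f (- n.+1%:Z)%R.
Proof.
move=> f0; rewrite (esumID [set k : int | (0 <= k)%R])//; congr (_ + _).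
  apply: reindex_esum; split.
  - by move=> n _.
  - by move=> m n _ _ [].
  - by move=> [n|n] [_ //= n0]; exists n.
apply: reindex_esum; split.
- by move=> n _ /=; split => //; apply/negP; rewrite -ltNge; lia.
- by move=> m n _ _ /= mn; lia.
- move=> [n|n] [_ /= n0]; first by exfalso; apply: n0.
  by exists n => //; rewrite NegzE.
Qed.

Lemma esum_natS (f : nat -> \bar R) : (forall n, 0 <= f n) ->
  \esum_(n in [set: nat]) f n = f 0%N + \esum_(n in [set: nat]) f n.+1.
Proof.
move=> f0; rewrite (esumID [set 0%N])//; congr (_ + _).
  by rewrite setTI esum_set1.
apply: reindex_esum; split => //.
- by move=> m n _ _ [].
- by move=> [|n] [_ //= n0]; exists n.
Qed.

Lemma esum_int_shift (f : int -> \bar R) (d : int) :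
  \esum_(k in [set: int]) f (k + d)%R = \esum_(k in [set: int]) f k.
Proof.
apply/esym; apply: reindex_esum; split=> //.
- by move=> m n _ _ /addIr.
- by move=> m _; exists (m - d)%R => //; rewrite subrK.
Qed.

Lemma esum_int_parity (f : int -> \bar R) : (forall k, 0 <= f k) ->
  \esum_(k in [set: int]) f k =
  \esum_(k in [set: int]) f (2 * k)%R + \esum_(k in [set: int]) f (2 * k + 1)%R.
Proof.
move=> f0.
rewrite (esumID [set k : int | exists j, k = 2 * j]%R)//; congr (_ + _).
  apply: reindex_esum; split.
  - by move=> n _; split => //; exists n.
  - by move=> m n _ _ /= mn; lia.
  - by move=> _ [_ [j ->]]; exists j.
apply: reindex_esum; split.
- by move=> n _; split => // -[j]; lia.
- by move=> m n _ _ /= mn; lia.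
- move=> k [_ kP].
  have [kE|kE] : (k = 2 * (k %/ 2)%Z \/ k = 2 * (k %/ 2)%Z + 1)%R by lia.
    by case: kP; exists (k %/ 2)%Z.
  by exists (k %/ 2)%Z.
Qed.

(* [Z^2] is tiled by the two cosets [x + y] even and [x + y] odd of an index-2
   sublattice, each parametrized by [Z^2]. *)
Lemma esum_int2_parity (f : int * int -> \bar R) : (forall p, 0 <= f p) ->
  \esum_(p in [set: int * int]) f p =
  \esum_(p in [set: int * int]) f (p.1 + p.2, p.2 - p.1)%R +
  \esum_(p in [set: int * int]) f (p.1 + p.2, p.1 - p.2 - 1)%R.
Proof.
move=> f0.
rewrite (esumID [set p : int * int | exists j, p.1 + p.2 = 2 * j]%R)//.
congr (_ + _); apply: reindex_esum; split.
- by move=> [j k] _; split => //; exists k => /=; lia.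
- by move=> [i j] [k l] _ _ /= [? ?]; congr (_, _); lia.
- move=> [x y] [_ [j /= jE]]; exists (x - j, j)%R => //=.
  by congr (_, _); lia.
- by move=> [j k] _; split => // -[l /=]; lia.
- by move=> [i j] [k l] _ _ /= [? ?]; congr (_, _); lia.
- move=> [x y] [_ /= kP]; set j := ((x + y) %/ 2)%Z.
  have [E|E] : (x + y = 2 * j \/ x + y = 2 * j + 1)%R by lia.
    by case: kP; exists j.
  by exists (j + 1, x - j - 1)%R => //=; congr (_, _); lia.
Qed.

Lemma esum_mul (S T : choiceType) (f : S -> R) (g : T -> R) :
  (forall i, 0 < f i)%R -> (forall j, 0 <= g j)%R ->
  \esum_(j in [set: T]) (g j)%:E \is a fin_num ->
  \esum_(p in [set: S * T]) (f p.1 * g p.2)%:E =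
  (\esum_(i in [set: S]) (f i)%:E) * (\esum_(j in [set: T]) (g j)%:E).
Proof.
move=> f0 g0 gfin.
have -> : [set: S * T] = [set: S] `*`` (fun=> [set: T]).
  by apply/seteqP; split => // -[].
rewrite -(esum_esum (a := fun i j => (f i * g j)%:E)); last first.
  by move=> i j _ _; rewrite lee_fin mulr_ge0// ltW.
under eq_esum do under eq_esum do rewrite EFinM.
under eq_esum do rewrite esumZl//.
set G := esum _ _ in gfin *.
have G0 : 0 <= G by apply: esum_ge0 => j _; rewrite lee_fin.
(* [esumZl] takes only positive factors, so a vanishing sum [G] is treated apart. *)
have [G00|Gn0] := eqVneq G 0.
  by rewrite G00 mule0 esum1// => i _; rewrite mule0.
rewrite -(fineK gfin) muleC -esumZl ?fine_gt0//.
- by apply: eq_esum => i _; rewrite muleC.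
- by rewrite lt_neqAle eq_sym Gn0 G0/= ltey_eq gfin.
- by move=> i; rewrite lee_fin ltW.
Qed.

Lemma esum_nat_telescope (u : nat -> R) (l : R) :
  (forall n, u n <= u n.+1)%R -> u @ \oo --> l ->
  \esum_(n in [set: nat]) (u n.+1 - u n)%:E = (l - u 0%N)%:E.
Proof.
move=> ndu ul; rewrite -nneseries_esumT; last first.
  by move=> n; rewrite lee_fin subr_ge0.
apply/cvg_lim => //; under eq_fun do rewrite sumEFin telescope_sumr//.
apply: cvg_EFin; first by near=> n.
by apply: cvgB => //; exact: cvg_cst.
Unshelve. all: end_near. Qed.

Lemma esum_int_telescope (u : int -> R) (l l' : R) :
  (forall k, u k <= u (k + 1))%R ->
  u n%:Z @[n --> \oo] --> l -> u (- n%:Z)%R @[n --> \oo] --> l' ->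
  \esum_(k in [set: int]) (u (k + 1) - u k)%:E = (l - l')%:E.
Proof.
move=> ndu ul ul'; rewrite esum_int_nat; last first.
  by move=> k; rewrite lee_fin subr_ge0.
have -> : \esum_(n in [set: nat]) (u (n%:Z + 1) - u n%:Z)%:E = (l - u 0)%:E.
  rewrite -(esum_nat_telescope (fun n => u n%:Z))//.
  - by apply: eq_esum => n _; congr ((u _ - _)%R%:E); lia.
  - by move=> n; rewrite (_ : n.+1%:Z = n%:Z + 1)%R//; lia.
have -> : \esum_(n in [set: nat]) (u (- n.+1%:Z + 1) - u (- n.+1%:Z))%:E =
    (u 0 - l')%:E.
  (* On the negative half, [- u (- n)] is nondecreasing in [n] and tends to [- l']. *)
  transitivity (- l' - (- u (- 0%:Z)))%:E; last by rewrite oppr0 opprK addrC.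
  rewrite -(esum_nat_telescope (fun n => - u (- n%:Z))%R)//.
  - apply: eq_esum => n _; congr (_%:E); rewrite opprK addrC.
    by congr (- _ + u _)%R; lia.
  - move=> n; rewrite lerN2 (_ : - n%:Z = - n.+1%:Z + 1)%R//; lia.
  - exact: cvgN.
by rewrite -EFinD; congr (_%:E); rewrite addrA subrK.
Qed.

(** A difference over [m] steps is a sum of [m] one-step differences; these are translates of a
    single family, so each contributes [l - l']. *)
Lemma esum_int_telescope_shift (u : int -> R) (l l' : R) (m : nat) :
  (forall k, u k <= u (k + 1))%R ->
  u n%:Z @[n --> \oo] --> l -> u (- n%:Z)%R @[n --> \oo] --> l' ->
  \esum_(k in [set: int]) (u (k + m%:Z) - u k)%:E = (m%:R * (l - l'))%:E.
Proof.
move=> ndu ul ul'.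
transitivity (\esum_(k in [set: int]) \sum_(0 <= i < m)
    (u (k + i%:Z + 1) - u (k + i%:Z))%:E).
  apply: eq_esum => k _; rewrite sumEFin.
  have := telescope_sumr (fun i : nat => u (k + i%:Z))%R (leq0n m).
  rewrite /= addr0 => <-; congr (_%:E); apply: eq_bigr => i _.
  by congr (u _ - _)%R; lia.
rewrite esum_sum; last by move=> k i _ _; rewrite lee_fin subr_ge0.
under eq_bigr => i _.
  rewrite (esum_int_shift (fun k => (u (k + 1) - u k)%:E)).
  rewrite (esum_int_telescope u l l' ndu ul ul'); over.
by rewrite sumEFin big_const_nat iter_addr_0 subn0 mulr_natl.
Qed.

End esum_int.

(** * Hyperbolic functions: product formula, telescoping identity, antiderivative of sech *)

Section hyperbolic.
Context {R : realType}.
Implicit Types x y h : R.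

Lemma coshN x : cosh (- x) = cosh x.
Proof. by rewrite /cosh opprK addrC. Qed.

Lemma cosh_gt0 x : 0 < cosh x.
Proof. by rewrite divr_gt0// addr_gt0// expR_gt0. Qed.

Lemma sechN x : sech (- x) = sech x.
Proof. by rewrite /sech coshN. Qed.

Lemma sech_gt0 x : 0 < sech x.
Proof. by rewrite divr_gt0// cosh_gt0. Qed.

Lemma sech0 : sech (0 : R) = 1.
Proof. by rewrite /sech /cosh oppr0 expR0 -[1 + 1]/(2 : R) !divff. Qed.

Lemma sech_le x y : 0 <= x -> x <= y -> sech y <= sech x.
Proof.
move=> x0 xy; rewrite /sech !div1r lef_pV2 ?posrE ?cosh_gt0//.
rewrite ler_pM2r//.
have ex1 : 1 <= expR x by rewrite -expR0 ler_expR.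
have exy : expR x <= expR y by rewrite ler_expR.
rewrite !expRN -subr_ge0.
have -> : expR y + (expR y)^-1 - (expR x + (expR x)^-1) =
    (expR y - expR x) * (1 - (expR x * expR y)^-1).
  by field; rewrite !gt_eqF ?expR_gt0.
rewrite mulr_ge0 ?subr_ge0// invf_le1 ?mulr_gt0 ?expR_gt0//.
by rewrite (le_trans ex1)// ler_peMr ?expR_ge0// (le_trans ex1).
Qed.

Definition tanh x := (expR x - expR (- x)) / (expR x + expR (- x)).

Lemma tanhN x : tanh (- x) = - tanh x.
Proof. by rewrite /tanh opprK -mulNr opprB [X in _ / X]addrC. Qed.

(** Isolates the deviation from 1, which equals [2 / (1 + expR (2 * x))]; monotonicity and the limit
    at infinity are both obtained by studying it. *)
Lemma tanhE x : tanh x = 1 - expR (- x) * sech x.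
Proof.
rewrite /tanh /sech /cosh expRN.
by field; rewrite !gt_eqF// ?addr_gt0 ?mulr_gt0 ?expR_gt0.
Qed.

Lemma tanh_le x y : x <= y -> tanh x <= tanh y.
Proof.
move=> xy; rewrite !tanhE lerD2l lerN2 /sech /cosh.
have E z : expR (- z) * (1 / ((expR z + expR (- z)) / 2)) = 2 / (1 + expR (2 * z)).
  rewrite (_ : 2 * z = z + z); last by ring.
  rewrite expRD expRN; have := expR_gt0 z => z0.
  by field; rewrite !gt_eqF// ?addr_gt0 ?mulr_gt0.
rewrite !E ler_pM2l// lef_pV2 ?posrE ?addr_gt0 ?expR_gt0//.
by rewrite lerD2l ler_expR ler_pM2l.
Qed.

Lemma cvgy_tanh (T : Type) (F : set_system T) {FF : Filter F} (f : T -> R) :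
  f x @[x --> F] --> +oo -> tanh (f x) @[x --> F] --> (1 : R).
Proof.
move=> fy; under eq_fun do rewrite tanhE.
suff : expR (- f x) * sech (f x) @[x --> F] --> (0 : R).
  by move=> /(cvgB (cvg_cst (1 : R))); rewrite subr0.
have : expR (- f x) @[x --> F] --> (0 : R) := cvg_comp _ _ fy (@cvgr_expR R).
apply: squeeze_cvgr (cvg_cst 0).
near=> x; rewrite mulr_ge0 ?expR_ge0 ?(ltW (sech_gt0 _))//=.
rewrite ler_piMr ?expR_ge0// -sech0 sech_le//.
by near: x; move/cvgryPge : fy; apply.
Unshelve. all: end_near. Qed.

Definition sinh x := (expR x - expR (- x)) / 2.

Lemma sinh_gt0 x : 0 < x -> 0 < sinh x.
Proof. by move=> x0; rewrite divr_gt0// subr_gt0 ltr_expR gtrN. Qed.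

(* [sech ((x + y) / 2) * sech ((x - y) / 2)], see [sech_mul]. *)
Definition sech2 x y := 2 / (cosh x + cosh y).

Lemma sech2_ge0 x y : 0 <= sech2 x y.
Proof. by rewrite divr_ge0// addr_ge0// ltW// cosh_gt0. Qed.

Lemma sech2C x y : sech2 x y = sech2 y x.
Proof. by rewrite /sech2 addrC. Qed.

Lemma sech2Nl x y : sech2 (- x) y = sech2 x y.
Proof. by rewrite /sech2 coshN. Qed.

Lemma sech_mul x y : sech x * sech y = sech2 (x + y) (x - y).
Proof.
rewrite /sech2 /sech /cosh !opprD !opprK !expRD !expRN.
have := expR_gt0 x; have := expR_gt0 y; move: (expR x) (expR y) => a b b0 a0.
have a2 : 0 < a * a + 1 by rewrite addr_gt0 ?mulr_gt0.
have b2 : 0 < b * b + 1 by rewrite addr_gt0 ?mulr_gt0.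
have ab : 0 < (a * a + 1) * (b * b + 1) by rewrite mulr_gt0.
field; do ?[apply/andP; split]; rewrite ?gt_eqF//.
by rewrite (lt_le_trans ab)//; lra.
Qed.

(** With a = (x + y) / 2 and b = (x - y) / 2, tanh a - tanh b = sinh (a - b) / (cosh a cosh b),
    where a - b = y and 2 cosh a cosh b = cosh x + cosh y. For fixed [y] this makes sums over
    equidistant [x] telescope. *)
Lemma sech2_tanh x y : y != 0 ->
  sech2 x y = (tanh ((x + y) / 2) - tanh ((x - y) / 2)) / sinh y.
Proof.
move=> y0; rewrite /sech2 /tanh /sinh /cosh.
have half (z : R) : expR z = expR (z / 2) ^+ 2 by rewrite expr2 -expRD; congr expR; field.
have : expR (y / 2) != 1 by rewrite -expR0 (inj_eq (@expR_inj R)) mulf_neq0// invr_neq0.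
rewrite (half x) (half y) (half (- x)) (half (- y)) !mulNr !mulrDl !mulNr.
rewrite !opprD !opprK !expRD !expRN.
have := expR_gt0 (x / 2); have := expR_gt0 (y / 2).
move: (expR (x / 2)) (expR (y / 2)) => a b b0 a0 b1.
have ab : 0 < a ^+ 2 + b ^+ 2 by rewrite addr_gt0 ?exprn_gt0.
have ab1 : 0 < a ^+ 2 * b ^+ 2 + 1 by rewrite addr_gt0 ?mulr_gt0 ?exprn_gt0.
have abab : 0 < (a ^+ 2 + b ^+ 2) * (a ^+ 2 * b ^+ 2 + 1) by rewrite mulr_gt0.
(* Up to a positive factor this is [sinh y], as [b] stands for [expR (y / 2)]. *)
have b4 : (b * b) ^+ 2 - 1 != 0.
  rewrite (_ : _ - 1 = (b - 1) * ((b + 1) * (b ^+ 2 + 1))); last by ring.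
  by rewrite mulf_neq0 ?subr_eq0// gt_eqF// mulr_gt0 ?addr_gt0 ?exprn_gt0.
field; do ?[apply/andP; split]; rewrite ?b4 ?gt_eqF//.
  by rewrite (lt_le_trans ab1)// le_eqVlt; apply/orP; left; apply/eqP; ring.
by rewrite (lt_le_trans abab)// le_eqVlt; apply/orP; left; apply/eqP; ring.
Qed.

(** The function is the Gudermannian shifted by pi/2. *)
Lemma is_derive_gd x : is_derive x 1 (fun t => 2 * atan (expR t)) (sech x).
Proof.
have -> : sech x = 2 * ((1 + expR x ^+ 2)^-1 * expR x).
  rewrite /sech /cosh expRN; have := expR_gt0 x => x0.
  by field; rewrite !gt_eqF ?addr_gt0 ?mulr_gt0 ?exprn_gt0.
apply: is_deriveZ; exact: is_derive1_comp.
Qed.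

(** Mean value theorem: [sech] decreases on the nonnegative axis, so its value at the intermediate
    point lies between the values at the ends. *)
Lemma gd_increment x y : 0 <= x -> x < y ->
  (y - x) * sech y <= 2 * atan (expR y) - 2 * atan (expR x) <= (y - x) * sech x.
Proof.
move=> x0 xy.
have [|c /[!in_itv]/= /andP[xc cy] ->] := MVT xy (fun t _ => is_derive_gd t).
  apply: derivable_within_continuous => t _.
  by have [] := is_derive_gd t.
have yx0 : 0 < y - x by rewrite subr_gt0.
have c0 : 0 <= c := le_trans x0 (ltW xc).
rewrite [sech c * _]mulrC.
by apply/andP; split; rewrite ler_pM2l// sech_le// ltW.
Qed.

End hyperbolic.

(** * Sums of sech over arithmetic progressions and the duplication formula *)

Section sech_sums.
Context {R : realType}.
Implicit Types h : R.

(** This is A(h). Taking [fine] loses nothing for [0 < h], where [sech_sumE] shows the sum to be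
    finite. *)
Definition sech_sum h : R := fine (\esum_(k in [set: int]) (sech (h * k%:~R))%:E).

(** Integral comparison: [g] climbs from pi/2 at 0 to pi at infinity, and its increment over the
    n-th step of length [h] lies between [h * sech (h * n.+1)] and [h * sech (h * n)]. *)
Lemma esum_sech_tail h : 0 < h -> exists s : R,
  \esum_(n in [set: nat]) (sech (h * n.+1%:R))%:E = s%:E /\
  pi / 2 - h <= h * s <= pi / 2.
Proof.
move=> h0; pose g (n : nat) := 2 * atan (expR (h * n%:R)).
have gn n : h * sech (h * n.+1%:R) <= g n.+1 - g n <= h * sech (h * n%:R).
  have -> : h = h * n.+1%:R - h * n%:R by rewrite -natr1; ring.
  rewrite /g -[n.+1%:R]natr1.
  rewrite (_ : h * (n%:R + 1) - h * n%:R = h); last by ring.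
  rewrite [X in X * sech (h * (_ + _))](_ : h = h * (n%:R + 1) - h * n%:R); last by ring.
  rewrite [X in _ <= X * _](_ : h = h * (n%:R + 1) - h * n%:R); last by ring.
  by apply: gd_increment; rewrite ?mulr_ge0 ?ltr_pM2l ?ltrDl// ltW.
have gy : g @ \oo --> pi.
  rewrite (_ : pi = 2 * (pi / 2)); last by field.
  apply: cvgM; first exact: cvg_cst.
  apply: (cvg_comp _ _ _ (@cvgy_atan R)).
  apply/cvgryPge => A.
  near=> n; rewrite (le_trans _ (expR_ge1Dx _))//.
  rewrite -lerBlDl -ler_pdivrMl//.
  near: n; exact: nbhs_infty_ger.
have gE : (\esum_(n in [set: nat]) (g n.+1 - g n)%:E = (pi / 2)%:E)%E.
  rewrite (esum_nat_telescope g pi)//.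
    congr EFin; rewrite /g mulr0 expR0 atan1.
    by field.
  move=> n; rewrite -subr_ge0; have /andP[+ _] := gn n.
  by apply: le_trans; rewrite mulr_ge0 ?(ltW h0)// ltW// sech_gt0.
have sge0 n : (0 <= (sech (h * n%:R))%:E)%E by rewrite lee_fin ltW// sech_gt0.
have le1 : (h%:E * (\esum_(n in [set: nat]) (sech (h * n.+1%:R))%:E) <= (pi / 2)%:E)%E.
  rewrite -esumZl// -gE; apply: le_esum => n _.
  by rewrite -EFinM lee_fin; have /andP[] := gn n.
(* The sum now starts at [n = 0]; its extra term [sech 0 = 1] is the source of the [- h] in the
   lower bound. *)
have ge1 : ((pi / 2)%:E <= h%:E * (\esum_(n in [set: nat]) (sech (h * n%:R))%:E))%E.
  rewrite -esumZl// -gE; apply: le_esum => n _.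
  by rewrite -EFinM lee_fin; have /andP[] := gn n.
set s := esum _ _ in le1.
have sfin : s \is a fin_num.
  rewrite ge0_fin_numE ?esum_ge0//.
  move: le1; rewrite -lee_pdivlMl// => /le_lt_trans; apply.
  by rewrite -EFinM ltry.
exists (fine s); split; first by rewrite fineK.
move: le1 ge1; rewrite esum_natS// -/s mulr0 sech0 -(fineK sfin) -EFinD -!EFinM.
by rewrite !lee_fin mulrDr mulr1 => -> ge1; rewrite lerBlDl ge1.
Unshelve. all: end_near. Qed.

Lemma esum_sech_int_nat h : 0 < h ->
  (\esum_(k in [set: int]) (sech (h * k%:~R))%:E =
   (1 + 2 * fine (\esum_(n in [set: nat]) (sech (h * n.+1%:R))%:E))%:E)%E.
Proof.
move=> h0; have [s [sE _]] := esum_sech_tail h h0.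
rewrite esum_int_nat; last by move=> k; rewrite lee_fin ltW// sech_gt0.
rewrite esum_natS; last by move=> k; rewrite lee_fin ltW// sech_gt0.
have -> : (\esum_(n in [set: nat]) (sech (h * (- n.+1%:Z)%:~R))%:E = s%:E)%E.
  by rewrite -sE; apply: eq_esum => n _; rewrite mulrNz mulrN sechN.
rewrite sE mulr0 sech0 -!EFinD /=.
by congr EFin; ring.
Qed.

Lemma sech_sumE h : 0 < h ->
  (\esum_(k in [set: int]) (sech (h * k%:~R))%:E = (sech_sum h)%:E)%E.
Proof. by move=> h0; rewrite /sech_sum esum_sech_int_nat. Qed.

Lemma esum_sech_nat h : 0 < h ->
  (\esum_(n in [set: nat]) (sech (h * n%:R))%:E = ((sech_sum h + 1) / 2)%:E)%E.
Proof.
move=> h0; rewrite /sech_sum esum_sech_int_nat//=.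
rewrite esum_natS; last by move=> k; rewrite lee_fin ltW// sech_gt0.
have [s [-> _]] := esum_sech_tail h h0.
by rewrite mulr0 sech0 -EFinD /=; congr EFin; field.
Qed.

Lemma sech_sum_ge1 h : 0 < h -> 1 <= sech_sum h.
Proof.
move=> h0; rewrite /sech_sum esum_sech_int_nat//= lerDl mulr_ge0// fine_ge0//.
by apply: esum_ge0 => n _; rewrite lee_fin ltW// sech_gt0.
Qed.

(** Controls both ends of the scale: h A(h) tends to pi as h tends to 0, and A(h) <= 1 + pi/h for
    large h. *)
Lemma sech_sum_bounds h : 0 < h -> pi - h <= h * sech_sum h <= pi + h.
Proof.
move=> h0; rewrite /sech_sum esum_sech_int_nat//=.
have [s [-> /= /andP[s1 s2]]] := esum_sech_tail h h0.
by apply/andP; split; nra.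
Qed.

(** The even multiples of [h] make up A(2h), which is finite and can be subtracted from A(h). *)
Lemma esum_sech_odd h : 0 < h ->
  (\esum_(k in [set: int]) (sech (h * (2 * k%:~R + 1)))%:E =
   (sech_sum h - sech_sum (2 * h))%:E)%E.
Proof.
move=> h0; have := sech_sumE h h0.
rewrite esum_int_parity; last by move=> k; rewrite lee_fin ltW// sech_gt0.
have -> : (\esum_(k in [set: int]) (sech (h * (2 * k)%:~R))%:E =
    (sech_sum (2 * h))%:E)%E.
  rewrite -sech_sumE ?mulr_gt0//; apply: eq_esum => k _.
  by rewrite intrM; congr ((sech _)%:E); ring.
have -> : (\esum_(k in [set: int]) (sech (h * (2 * k + 1)%:~R))%:E =
    \esum_(k in [set: int]) (sech (h * (2 * k%:~R + 1)))%:E)%E.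
  by apply: eq_esum => k _; rewrite intrD intrM.
move=> E; rewrite EFinB -E [X in (X - _)%E]addeC addeK//.
Qed.

Lemma esum_sech_odd_nat h : 0 < h ->
  (\esum_(n in [set: nat]) (sech (h * (2 * n%:R + 1)))%:E =
   ((sech_sum h - sech_sum (2 * h)) / 2)%:E)%E.
Proof.
move=> h0; have := esum_sech_odd h h0.
rewrite esum_int_nat; last by move=> k; rewrite lee_fin ltW// sech_gt0.
(* The reflection k -> - k - 1 changes the sign of 2k + 1, so the negative indices repeat the
   nonnegative ones. *)
have -> : (\esum_(n in [set: nat]) (sech (h * (2 * (- n.+1%:Z)%:~R + 1)))%:E =
    \esum_(n in [set: nat]) (sech (h * (2 * n%:R + 1)))%:E)%E.
  apply: eq_esum => n _; rewrite -[in RHS]sechN; congr ((sech _)%:E).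
  by rewrite mulrNz -[(n.+1)%:~R]/(n.+1%:R : R) -natr1; ring.
set s := esum _ _ => E.
have : (2%:E * s = (sech_sum h - sech_sum (2 * h))%:E)%E.
  by rewrite -E mule_natl mule2n.
move=> /(congr1 (fun z => (2^-1)%:E * z)%E).
rewrite muleA -EFinM mulVf// mul1e => ->.
by rewrite -EFinM mulrC.
Qed.

Lemma sech_sum_lt h : 0 < h -> sech_sum (2 * h) < sech_sum h.
Proof.
move=> h0; rewrite -subr_gt0 -lte_fin -esum_sech_odd//.
(* The single term [k = 0] already makes the odd sum positive. *)
apply: (@lt_le_trans _ _ (sech (h * (2 * 0 + 1)))%:E).
  by rewrite lte_fin sech_gt0.
rewrite -(@esum_set1 R int 0 (fun k : int => (sech (h * (2 * k%:~R + 1)))%:E)).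
  rewrite [leRHS](esumID [set (0 : int)]).
    by rewrite setTI leeDl// esum_ge0// => k _; rewrite lee_fin ltW// sech_gt0.
  by move=> k _; rewrite lee_fin ltW// sech_gt0.
by rewrite lee_fin ltW// sech_gt0.
Qed.

(* For fixed [y = h * m] the terms are differences of [tanh] over [m] steps, so
   the sum telescopes to a value independent of the offset [c]. *)
Lemma esum_sech2 h (m : nat) (c : R) : 0 < h -> (0 < m)%N ->
  (\esum_(k in [set: int]) (sech2 (h * m%:R) (h * (2 * k%:~R) + c))%:E =
   (m%:R * (2 / sinh (h * m%:R)))%:E)%E.
Proof.
move=> h0 m0; have hm0 : 0 < h * m%:R by rewrite mulr_gt0// ltr0n.
have sm0 := sinh_gt0 _ hm0.
(* Chosen so that [u (k + m) - u k] is [sech2_tanh] with [h * (2 * k) + c] for [x] and [h * m] for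
   [y]. *)
pose u (k : int) : R := tanh (h * k%:~R + (c - h * m%:R) / 2) / sinh (h * m%:R).
have ndu k : u k <= u (k + 1).
  rewrite ler_pM2r ?invr_gt0// tanh_le// lerD2r ler_pM2l// ler_int; lia.
have cvg_arg (d : R) : h * n%:R + d @[n --> \oo] --> +oo.
  apply/cvgryPge => A; near=> n.
  rewrite -lerBlDr -ler_pdivrMl//.
  near: n; exact: nbhs_infty_ger.
have ul : u n%:Z @[n --> \oo] --> (sinh (h * m%:R))^-1.
  rewrite -[in X in _ --> X](mul1r (sinh _)^-1); apply: cvgM; last exact: cvg_cst.
  exact: (cvgy_tanh _ _ _ (cvg_arg _)).
have ul' : u (- n%:Z) @[n --> \oo] --> - (sinh (h * m%:R))^-1.
  rewrite -[in X in _ --> X](mul1r (sinh _)^-1) -mulNr.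
  apply: cvgM; last exact: cvg_cst.
  under eq_fun => n.
    rewrite mulrNz -[X in tanh X]opprK tanhN opprD mulrN opprK; over.
  by apply: cvgN; exact: (cvgy_tanh _ _ _ (cvg_arg _)).
have := esum_int_telescope_shift u _ _ m ndu ul ul'.
rewrite (_ : _^-1 - - _^-1 = 2 / sinh (h * m%:R)); last by rewrite opprK; ring.
move=> <-; apply: eq_esum => k _; congr EFin.
rewrite sech2C sech2_tanh ?gt_eqF// mulrBl /u; congr (tanh _ / _ - tanh _ / _).
  by rewrite intrD -[m%:~R]/(m%:R : R); field.
by field.
Unshelve. all: end_near. Qed.

(** For each fixed odd multiple in the first argument, [esum_sech2] gives the inner sum the same
    value at offset 0 (even multiples) and at offset [h] (odd multiples). *)
Lemma esum_sech2_parity h : 0 < h ->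
  (\esum_(p in [set: int * int])
     (sech2 (h * (2 * p.1%:~R + 1)) (h * (2 * p.2%:~R)))%:E =
   \esum_(p in [set: int * int])
     (sech2 (h * (2 * p.1%:~R + 1)) (h * (2 * p.2%:~R + 1)))%:E)%E.
Proof.
move=> h0.
have -> : [set: int * int] = [set: int] `*`` (fun=> [set: int]).
  by apply/seteqP; split => // -[].
rewrite -(esum_esum (a := fun i j : int =>
  (sech2 (h * (2 * i%:~R + 1)) (h * (2 * j%:~R)))%:E)); last first.
  by move=> i j _ _; rewrite lee_fin sech2_ge0.
rewrite -(esum_esum (a := fun i j : int =>
  (sech2 (h * (2 * i%:~R + 1)) (h * (2 * j%:~R + 1)))%:E)); last first.
  by move=> i j _ _; rewrite lee_fin sech2_ge0.
apply: eq_esum => i _.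
(* [m] is the absolute value of 2i + 1: positive by oddness, and the sign is absorbed since [sech2]
   is even in its first argument. *)
have [m [m0 mE]] : exists m : nat, (0 < m)%N /\ forall x : R,
    sech2 (h * (2 * i%:~R + 1)) x = sech2 (h * m%:R) x.
  exists (absz (2 * (i : int) + 1)); split; first by lia.
  move=> x; have [i0|i0] := lerP 0 (2 * (i : int) + 1).
    rewrite -[X in sech2 _ x = sech2 (h * X) x]/((absz (2 * (i : int) + 1) : int)%:~R).
    by rewrite abszE ger0_norm// intrD intrM.
  rewrite -[X in sech2 _ x = sech2 (h * X) x]/((absz (2 * (i : int) + 1) : int)%:~R).
  rewrite abszE ltr0_norm// mulrNz mulrN sech2Nl.
  by rewrite intrD intrM.
transitivity (m%:R * (2 / sinh (h * m%:R)))%:E.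
  rewrite -(esum_sech2 h m 0 h0 m0); apply: eq_esum => j _.
  by rewrite mE addr0.
rewrite -(esum_sech2 h m h h0 m0); apply: eq_esum => j _.
by rewrite mE mulrDr mulr1.
Qed.

(* Both sides are double series in [sech2]: the change of variables [x + y],
   [x - y] turns the square into twice the sum over (odd, even) pairs, and the
   product into twice the sum over (odd, odd) pairs. *)
Lemma sech_sum_landen h : 0 < h ->
  (sech_sum (h / 2) - sech_sum h) ^+ 2 =
  4 * sech_sum (2 * h) * (sech_sum h - sech_sum (2 * h)).
Proof.
move=> h0.
pose P := (\esum_(p in [set: int * int])
     (sech2 (h * (2 * p.1%:~R + 1)) (h * (2 * p.2%:~R)))%:E)%E.
have PE : P = (\esum_(p in [set: int * int])
     (sech2 (h * (2 * p.2%:~R + 1)) (h * (2 * p.1%:~R)))%:E)%E.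
  rewrite /P (reindex_esum [set: int * int] _ (fun p => (p.2, p.1)))//.
  split => //; first by move=> [a b] [c d] _ _ /= [-> ->].
  by move=> [a b] _; exists (b, a).
(* The terms of the square are [sech2] of h(i + j + 1) and h(i - j), one odd and one even multiple
   of [h]. Each parity class of i + j runs through all (odd, even) pairs once, up to swapping the
   arguments. *)
have sqE : ((sech_sum (h / 2) - sech_sum h) ^+ 2)%:E = (P + P)%E.
  have E : (\esum_(k in [set: int]) (sech (h / 2 * (2 * k%:~R + 1)))%:E =
     (sech_sum (h / 2) - sech_sum h)%:E)%E.
    by rewrite esum_sech_odd ?divr_gt0// (_ : 2 * (h / 2) = h)//; field.
  rewrite expr2 EFinM -E -esum_mul; last 3 first.
  - by move=> k; exact: sech_gt0.
  - by move=> k; rewrite ltW// sech_gt0.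
  - by rewrite E.
  rewrite esum_int2_parity; last first.
    by move=> p; rewrite lee_fin mulr_ge0// ltW// sech_gt0.
  congr (_ + _)%E.
    rewrite PE; apply: eq_esum => -[j k] _ /=; rewrite sech_mul.
    by rewrite !intrD !rmorphN /=; congr ((sech2 _ _)%:E); field.
  rewrite PE; apply: eq_esum => -[j k] _ /=; rewrite sech_mul sech2C.
  by rewrite !intrD !rmorphN /=; congr ((sech2 _ _)%:E); field.
(* After passing from (odd, even) to (odd, odd) pairs, half sum and half difference are one even and
   one odd multiple of [h], up to sign; either coset thus yields the whole product. *)
have prodE : ((2 * (sech_sum (2 * h) * (sech_sum h - sech_sum (2 * h))))%:E = P)%E.
  rewrite /P esum_sech2_parity// esum_int2_parity; last first.
    by move=> p; rewrite lee_fin sech2_ge0.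
  rewrite mulr_natl mulr2n EFinD EFinM -esum_sech_odd// -sech_sumE ?mulr_gt0//.
  rewrite -esum_mul; last 3 first.
  - by move=> k; exact: sech_gt0.
  - by move=> k; rewrite ltW// sech_gt0.
  - by rewrite esum_sech_odd.
  congr (_ + _)%E; apply: eq_esum => -[j k] _ /=; rewrite sech_mul.
    rewrite sech2C -sech2Nl sech2C.
    by rewrite !intrD !rmorphN /=; congr ((sech2 _ _)%:E); ring.
  by rewrite !intrD !rmorphN /=; congr ((sech2 _ _)%:E); ring.
apply: EFin_inj; rewrite sqE -prodE -EFinD; congr EFin; ring.
Qed.

End sech_sums.

(** * Arithmetic-geometric mean iterations and uniqueness of the second starting value *)

Section agm_sequences.
Context {R : realType}.
Implicit Types (a b : nat -> R) (h m : R).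

(** The geometric mean is given through its square; positivity then determines [b n.+1]. *)
Definition agm_seq a b := forall n,
  [/\ 0 < a n, 0 < b n, a n.+1 = (a n + b n) / 2 & b n.+1 ^+ 2 = a n * b n].

Lemma agm_seq_scale a b c : 0 < c -> agm_seq a b ->
  agm_seq (fun n => a n / c) (fun n => b n / c).
Proof.
move=> c0 ab n; have [a0 b0 aE bE] := ab n.
split; rewrite ?divr_gt0//; first by rewrite aE; field; rewrite gt_eqF.
by rewrite expr_div_n bE; field; rewrite gt_eqF.
Qed.

Lemma agm_seq_cvg a b m : agm_seq a b -> a @ \oo --> m -> b @ \oo --> m.
Proof.
move=> ab am; have -> : b = (fun n => 2 * a n.+1 - a n).
  by apply/funext => n; have [_ _ -> _] := ab n; field.
rewrite (_ : m = 2 * m - m); last by ring.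
apply: cvgB => //; apply: cvgM; first exact: cvg_cst.
by rewrite (cvg_shiftS a).
Qed.

(* After one step both means have grown by a factor [c > 1], and homogeneity
   preserves this factor in the limit. *)
Lemma agm_lim_inj a b a' b' m : agm_seq a b -> agm_seq a' b' -> 0 < m ->
  a @ \oo --> m -> a' @ \oo --> m -> a 0%N = a' 0%N -> b 0%N = b' 0%N.
Proof.
move=> ab ab' m0 am a'm a0E; apply/eqP.
apply: contraPT isT => b0E; move: b0E; rewrite neq_lt => /orP b0E.
wlog {b0E} b0lt : a b a' b' ab ab' am a'm a0E / b 0%N < b' 0%N.
  move=> wl; case: b0E => lt; first exact: (wl a b a' b').
  by apply: (wl a' b' a b) => //; left.
have [a0 b0 aE bE] := ab 0%N; have [a0' b0' aE' bE'] := ab' 0%N.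
have [a1 b1 _ _] := ab 1%N; have [a1' b1' _ _] := ab' 1%N.
have a1lt : a 1%N < a' 1%N by rewrite aE aE' ltr_pM2r// a0E ltrD2l.
have b1lt : b 1%N < b' 1%N.
  by rewrite -(ltr_pXn2r (n := 2)) ?nnegrE ?ltW// bE bE' a0E ltr_pM2l.
pose c := Num.min (a' 1%N / a 1%N) (b' 1%N / b 1%N).
have c1 : 1 < c by rewrite lt_min !ltr_pdivlMr// !mul1r a1lt.
have c0 : 0 < c by rewrite (lt_trans _ c1).
have step n : c * a n.+1 <= a' n.+1 /\ c * b n.+1 <= b' n.+1.
  elim: n => [|n [IHa IHb]].
    by split; rewrite -ler_pdivlMr// ge_min lexx ?orbT.
  have [an bn aEn bEn] := ab n.+1; have [an' bn' aEn' bEn'] := ab' n.+1.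
  have [_ bn1 _ _] := ab n.+2; have [_ bn1' _ _] := ab' n.+2.
  split; first by rewrite aEn aEn' mulrA mulrDr ler_pM2r// lerD.
  have cb0 : 0 <= c * b n.+2 := mulr_ge0 (ltW c0) (ltW bn1).
  rewrite -(ler_pXn2r (n := 2)) ?nnegrE ?(ltW bn1')//.
  rewrite exprMn bEn bEn' expr2 mulrACA.
  by apply: ler_pM => //; rewrite mulr_ge0// ltW.
have : c * m <= m.
  have cam : c * a n.+1 @[n --> \oo] --> c * m.
    by apply: cvgM; [exact: cvg_cst | rewrite (cvg_shiftS a)].
  have a'Sm : a' n.+1 @[n --> \oo] --> m by rewrite (cvg_shiftS a').
  apply: (ler_cvg_to cam a'Sm); apply: nearW => n.
  by have [] := step n.
by rewrite leNgt ltr_pMl// c1.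
Qed.

End agm_sequences.

(** * The two iterations formed by sech sums, and their comparison at h = pi *)

Section sech_sum_agm.
Context {R : realType}.
Implicit Types h : R.

Local Notation A := (@sech_sum R).

Lemma cvg_geom_half (c : R) : c / 2 ^+ n @[n --> \oo] --> (0 : R).
Proof.
rewrite -(mulr0 c); apply: cvgM; first exact: cvg_cst.
under eq_fun do rewrite -exprVn.
by apply: cvg_expr; rewrite ger0_norm// invf_lt1// ltr1n.
Qed.

Lemma cvg_sech_sum_up h : 0 < h -> A (2 ^+ n * h) @[n --> \oo] --> (1 : R).
Proof.
move=> h0.
have : 1 + pi / h / 2 ^+ n @[n --> \oo] --> (1 : R).
  rewrite -[X in _ --> X]addr0.
  by apply: cvgD; [exact: cvg_cst | exact: cvg_geom_half].
move=> up; apply: (squeeze_cvgr _ (cvg_cst (1 : R)) up); apply: nearW => n.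
have hn0 : 0 < 2 ^+ n * h by rewrite mulr_gt0// exprn_gt0.
rewrite sech_sum_ge1//=; have /andP[_] := sech_sum_bounds _ hn0.
rewrite -ler_pdivlMl// => /le_trans; apply.
rewrite le_eqVlt; apply/orP; left; apply/eqP.
by field; rewrite !gt_eqF// exprn_gt0.
Qed.

(** The delicate point is positivity of [b]. The relation [b n.+1 ^+ 2 = a n * b n] passes
    positivity from [n.+1] down to [n], and [b] tends to 1, so it is positive far out and hence
    everywhere. *)
Lemma agm_seq_up h : 0 < h ->
  agm_seq (fun n => A (2 ^+ n * h))
          (fun n => 2 * A (2 ^+ n.+1 * h) - A (2 ^+ n * h)).
Proof.
move=> h0; set a := (X in agm_seq X _); set b := (X in agm_seq _ X).
have hn0 n : 0 < 2 ^+ n * h by rewrite mulr_gt0// exprn_gt0.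
have a0 n : 0 < a n by rewrite (lt_le_trans ltr01)// sech_sum_ge1.
(* With x, y, z three successive values of [a], (2z - y)^2 = x (2y - x) is a rearrangement of the
   duplication formula (x - y)^2 = 4z (y - z). *)
have bE n : b n.+1 ^+ 2 = a n * b n.
  have := sech_sum_landen _ (hn0 n.+1).
  rewrite mulrA -exprS (_ : 2 ^+ n.+1 * h / 2 = 2 ^+ n * h).
    by rewrite /b /a; move: (A _) (A _) (A _) => x y z; lra.
  by rewrite exprS; field.
have b_ge0 n : 0 <= b n by rewrite -(pmulr_rge0 _ (a0 n)) -bE sqr_ge0.
have bS_gt0 n : 0 < b n.+1 -> 0 < b n.
  by move=> bn; rewrite -(pmulr_rgt0 _ (a0 n)) -bE exprn_gt0.
have bD_gt0 n k : 0 < b (n + k)%N -> 0 < b n.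
  by elim: k => [|k IH]; rewrite ?addn0// addnS => /bS_gt0.
have b1 : b @ \oo --> (1 : R).
  rewrite (_ : 1 = 2 * 1 - 1); last by ring.
  apply: cvgB; last exact: cvg_sech_sum_up.
  apply: cvgM; first exact: cvg_cst.
  by rewrite (cvg_shiftS a); exact: cvg_sech_sum_up.
move=> n; split => //; last by rewrite /a /b; field.
have [N _ bN] : \forall k \near \oo, 0 < b k := cvgr_gt _ b1 _ ltr01.
by apply: (bD_gt0 n N); apply: bN => /=; exact: leq_addl.
Qed.

Lemma cvg_sech_sum_down h : 0 < h ->
  A (h / 2 ^+ n) / 2 ^+ n @[n --> \oo] --> pi / h.
Proof.
move=> h0.
have cvg_bound (s : R) : pi / h + s / 2 ^+ n @[n --> \oo] --> pi / h.
  rewrite -[X in _ --> X]addr0.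
  by apply: cvgD; [exact: cvg_cst | exact: cvg_geom_half].
apply: (squeeze_cvgr _ (cvg_bound (- 1)) (cvg_bound 1)); apply: nearW => n.
have e0 : 0 < (2 : R) ^+ n by rewrite exprn_gt0.
have /andP[] := sech_sum_bounds (h / 2 ^+ n) (divr_gt0 h0 e0).
set x := A _ => lo hi.
rewrite -(ler_pM2l h0) -[X in _ && X](ler_pM2l h0).
have -> : h * (x / 2 ^+ n) = h / 2 ^+ n * x by ring.
have E s : h * (pi / h + s / 2 ^+ n) = pi + s * (h / 2 ^+ n).
  by field; rewrite !gt_eqF.
by rewrite !E mulN1r mul1r lo.
Qed.

(** The geometric relation is the duplication formula at [h / 2 ^+ n.+1], whose factor 4 the
    normalization by [2 ^+ n] absorbs. Positivity of the second sequence is [sech_sum_lt]. *)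
Lemma agm_seq_down h : 0 < h ->
  agm_seq (fun n => A (h / 2 ^+ n) / 2 ^+ n)
          (fun n => (A (h / 2 ^+ n.+1) - A (h / 2 ^+ n)) / 2 ^+ n).
Proof.
move=> h0 n.
have e0 k : 0 < (2 : R) ^+ k by rewrite exprn_gt0.
have he0 k : 0 < h / 2 ^+ k by rewrite divr_gt0.
have dbl k : h / 2 ^+ k = 2 * (h / 2 ^+ k.+1).
  by rewrite exprS; field; rewrite gt_eqF.
split.
- by rewrite divr_gt0// (lt_le_trans ltr01)// sech_sum_ge1.
- by rewrite divr_gt0// subr_gt0 dbl sech_sum_lt.
- by rewrite !exprS; field; rewrite gt_eqF.
have := sech_sum_landen _ (he0 n.+1); rewrite -dbl.
rewrite (_ : h / 2 ^+ n.+1 / 2 = h / 2 ^+ n.+2); last first.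
  by rewrite !exprS; field; rewrite gt_eqF.
rewrite expr_div_n => ->.
by rewrite exprS; field; rewrite gt_eqF.
Qed.

(** Equivalently A(pi/2) = 2 A(2 pi), an instance of the Poisson symmetry A(h) = (pi/h) A(pi^2/h).
    It comes here from [agm_lim_inj], as pi/h = 1 at h = pi. *)
Lemma sech_sum_pi_selfdual : A (pi / 2) - A pi = 2 * A (2 * pi) - A pi.
Proof.
have pi0 := pi_gt0 R.
have := @agm_lim_inj R _ _ _ _ 1 (agm_seq_down pi pi0) (agm_seq_up pi pi0) ltr01.
rewrite /= !expr0 !expr1 !divr1 mul1r; apply => //.
  by rewrite -[X in _ --> X](divff (lt0r_neq0 pi0)); exact: cvg_sech_sum_down.
exact: cvg_sech_sum_up.
Qed.

(** Put c = A(pi/2) - A(pi). Self-duality gives A(2 pi) = (A(pi) + c) / 2, and the duplication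
    formula at pi becomes c^2 = A(pi)^2 - c^2. *)
Lemma sech_sum_pi_sqrt2 : A pi = Num.sqrt 2 * (A (pi / 2) - A pi).
Proof.
have pi0 := pi_gt0 R.
have lt2 : 0 < A (pi / 2) - A pi.
  rewrite subr_gt0 -[X in A X < _](_ : 2 * (pi / 2) = pi); last by field.
  by rewrite sech_sum_lt// divr_gt0.
have A0 : 0 < A pi by rewrite (lt_le_trans ltr01)// sech_sum_ge1.
have := sech_sum_landen _ pi0; have := sech_sum_pi_selfdual.
move: (A (pi / 2) - A pi) (A (2 * pi)) lt2 => c x c0 cE c2.
rewrite -[LHS]ger0_norm ?(ltW A0)// -sqrtr_sqr -(ger0_norm (ltW c0)) -sqrtr_sqr.
rewrite -sqrtrM//; congr Num.sqrt.
have xE : x = (c + A pi) / 2 by rewrite cE; field.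
have : c ^+ 2 = A pi ^+ 2 - c ^+ 2 by rewrite [LHS]c2 xE; field.
lra.
Qed.

End sech_sum_agm.

(** * Change of variables for improper integrals over the positive half-line *)

Section substitution.
Context {R : realType}.
Local Notation mu := (@lebesgue_measure R).

Lemma ge0_cvg_integral_itvcc (B : set R) (G : R -> R) (c d : nat -> R) :
  {homo c : n m / (n <= m)%N >-> m <= n} ->
  {homo d : n m / (n <= m)%N >-> n <= m} ->
  \bigcup_n `[c n, d n]%classic = B ->
  (forall y : R, B y -> {for y, continuous G}) -> (forall y : R, B y -> 0 <= G y) ->
  (\int[mu]_(x in `[c n, d n]) (G x)%:E @[n --> \oo] -->
   \int[mu]_(x in B) (G x)%:E)%E.
Proof.
move=> nic ndd <- cG G0.
apply: ge0_nondecreasing_set_cvg_integral => //.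
- move=> n m nm; rewrite subsetEset => x /=; rewrite !in_itv/= => /andP[cx xd].
  by rewrite (le_trans (nic _ _ nm) cx) (le_trans xd (ndd _ _ nm)).
- move=> n; apply/measurable_EFinP.
  apply: subspace_continuous_measurable_fun => //.
  apply: continuous_in_subspaceT => x /set_mem xcd; apply: cG.
  by exists n.
- by move=> n x xn; rewrite lee_fin; apply: G0; exists n.
Qed.

Lemma bigcup_itvV : \bigcup_n `[n.+1%:R^-1, n.+1%:R]%classic = `]0, +oo[%classic :> set R.
Proof.
apply/seteqP; split => x.
  move=> [n _] /=; rewrite !in_itv/= andbT => /andP[+ _].
  by apply: lt_le_trans; rewrite invr_gt0 ltr0n.
rewrite /= in_itv/= andbT => x0.
have [N _ HN] : \forall n \near \oo, Num.max x x^-1 <= n%:R by exact: nbhs_infty_ger.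
have := HN N (leqnn N); rewrite ge_max => /andP[xN xVN].
have NS : (N%:R : R) <= N.+1%:R by rewrite ler_nat.
exists N => //=; rewrite in_itv/= (le_trans xN NS) andbT.
by rewrite -[leRHS]invrK lef_pV2 ?posrE ?invr_gt0 ?ltr0n// (le_trans xVN NS).
Qed.

(** Substitution on the compact intervals from 1/(n+1) to n+1, followed by monotone convergence on
    both sides. The map [g] only witnesses that [F] is onto [B], so that the image intervals exhaust
    [B]. *)
Lemma ge0_integration_by_substitution0y (F f g G : R -> R) (B : set R) :
  is_interval B ->
  {in `]0, +oo[ &, {homo F : x y / x < y}} ->
  (forall x : R, 0 < x -> is_derive x 1 F (f x)) ->
  (forall x : R, 0 < x -> {for x, continuous f}) ->
  (forall x : R, 0 < x -> B (F x)) ->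
  (forall y : R, B y -> 0 < g y /\ F (g y) = y) ->
  (forall y : R, B y -> {for y, continuous G}) ->
  (forall y : R, B y -> 0 <= G y) ->
  (\int[mu]_(y in B) (G y)%:E = \int[mu]_(x in `]0%R, +oo[) (G (F x) * f x)%:E)%E.
Proof.
move=> iB incF dF cf FB gP cG G0.
have dFE (x : R) : 0 < x -> derive1 F x = f x.
  by move=> x0; rewrite derive1E; have [_ ->] := dF x x0.
have cF (x : R) : 0 < x -> {for x, continuous F}.
  move=> x0; apply/differentiable_continuous/derivable1_diffP.
  by have [] := dF x x0.
have cF' (x : R) : 0 < x -> derive1 F y @[y --> x] --> derive1 F x.
  move=> x0; rewrite dFE//; apply: cvg_trans (cf x x0).
  apply: near_eq_cvg; near=> y; rewrite dFE//.
  by near: y; exact: lt_nbhsr.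
have leF (x y : R) : 0 < x -> x <= y -> F x <= F y.
  move=> x0; rewrite le_eqVlt => /predU1P[->//|xy].
  by rewrite ltW// incF// in_itv/= andbT// (lt_trans x0).
have f0 (x : R) : 0 < x -> 0 <= f x.
  move=> x0; rewrite -dFE//.
  apply: (@incr_derive1_ge0 _ _ `]0, +oo[%classic).
  - move=> y; rewrite interior_itv inE /= in_itv/= andbT => y0.
    by have [] := dF y y0.
  - by move=> y z; rewrite !inE; exact: incF.
  - by rewrite interior_itv /= in_itv/= x0.
pose c (n : nat) : R := n.+1%:R^-1; pose d (n : nat) : R := n.+1%:R.
have c0 n : 0 < c n by rewrite invr_gt0.
have cd n : c n <= d n.
  by rewrite (le_trans (y := 1))// ?invf_le1// ?ler1n.
have nic : {homo c : n m / (n <= m)%N >-> m <= n}.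
  by move=> n m nm; rewrite lef_pV2 ?posrE// ler_nat.
have ndd : {homo d : n m / (n <= m)%N >-> n <= m}.
  by move=> n m nm; rewrite ler_nat.
have BE : \bigcup_n `[F (c n), F (d n)]%classic = B.
  apply/seteqP; split => y.
    move=> [n _] /=; rewrite in_itv/=; apply: iB; apply: FB => //.
  move=> By; have [gy0 <-] := gP y By.
  have : `]0, +oo[%classic (g y) by rewrite /= in_itv/= gy0.
  rewrite -bigcup_itvV => -[n _] /=; rewrite in_itv/= => /andP[cg gd].
  by exists n => //=; rewrite in_itv/= !leF.
have cvgL : (\int[mu]_(y in `[F (c n), F (d n)]) (G y)%:E @[n --> \oo]
    --> \int[mu]_(y in B) (G y)%:E)%E.
  apply: ge0_cvg_integral_itvcc => // n m nm.
    by apply: leF => //; exact: nic.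
  by apply: leF => //; exact: ndd.
have cvgR : (\int[mu]_(x in `[c n, d n]) (G (F x) * f x)%:E
    @[n --> \oo] --> \int[mu]_(x in `]0%R, +oo[) (G (F x) * f x)%:E)%E.
  apply: (@ge0_cvg_integral_itvcc _ (fun x => G (F x) * f x)) => //.
  - exact: bigcup_itvV.
  - move=> x /=; rewrite in_itv/= andbT => x0.
    apply: cvgM; last exact: cf.
    by apply: continuous_comp; [exact: cF | apply: cG; exact: FB].
  - move=> x /=; rewrite in_itv/= andbT => x0.
    by rewrite mulr_ge0 ?f0// G0//; exact: FB.
apply: (@cvg_unique _ (@ereal_hausdorff R) _ _ _ _ cvgL).
apply: cvg_trans cvgR; apply: near_eq_cvg; apply: nearW => n.
rewrite integration_by_substitution_increasing//.
- apply: eq_integral => x /[!inE]/=; rewrite in_itv/= => /andP[cx _].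
  by rewrite fctE/= dFE// (lt_le_trans (c0 n)).
- move=> x y; rewrite !in_itv/= => /andP[cx _] /andP[cy _] xy.
  by apply: incF => //; rewrite in_itv/= andbT (lt_le_trans (c0 n)).
- move=> x; rewrite in_itv/= => /andP[cx _]; apply: cF'.
  by rewrite (lt_trans (c0 n)).
- apply/cvg_ex; eexists; apply: cvg_at_right_filter; exact: cF'.
- apply/cvg_ex; eexists; apply: cvg_at_left_filter; exact: cF'.
- split.
  + move=> x; rewrite in_itv/= => /andP[cx _].
    by have [] := dF x (lt_trans (c0 n) cx).
  + by apply: cvg_at_right_filter; exact: cF.
  + by apply: cvg_at_left_filter; exact: cF.
- apply: continuous_in_subspaceT => y /set_mem yn; apply: cG.
  by rewrite -BE; exists n.
Unshelve. all: end_near. Qed.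

End substitution.

(** * Gauss's integral for the arithmetic-geometric mean *)

Section agm_integral.
Context {R : realType}.
Implicit Types a b m x t : R.
Local Notation mu := (@lebesgue_measure R).

Lemma ge0_even_integralT (f : R -> R) : (forall x, 0 <= f x) -> continuous f ->
  (forall x, f (- x) = f x) ->
  (\int[mu]_x (f x)%:E = 2%:E * \int[mu]_(x in `]0%R, +oo[) (f x)%:E)%E.
Proof.
move=> f0 cf fN; rewrite ge0_symfun_integralT//; last by move=> x /=; rewrite fN.
congr (_ * _)%E; rewrite -set_itvcy integral_itv_obnd_cbnd//.
apply/measurable_EFinP/measurable_funTS.
exact: continuous_measurable_fun.
Qed.

(** The map t -> (t - c/t) / 2 increases from the positive half-line onto the whole line; y is
    attained at the positive root y + sqrt (y^2 + c) of t^2 - 2yt - c = 0. *)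
Lemma ge0_integral_landen c (G : R -> R) : 0 < c -> continuous G ->
  (forall x, 0 <= G x) ->
  (\int[mu]_x (G x)%:E =
   \int[mu]_(t in `]0%R, +oo[) (G ((t - c / t) / 2) * ((1 + c / t ^+ 2) / 2))%:E)%E.
Proof.
move=> c0 cG G0.
apply: (@ge0_integration_by_substitution0y _ (fun t => (t - c / t) / 2)
  (fun t => (1 + c / t ^+ 2) / 2) (fun y => y + Num.sqrt (y ^+ 2 + c))) => //.
- move=> s t; rewrite !in_itv/= !andbT => s0 t0 st.
  by rewrite ltr_pM2r// ltrD// ltrN2 ltr_pM2l// ltf_pV2.
- move=> t t0; have tn0 : t != 0 by rewrite gt_eqF.
  have dF := is_deriveZ 2^-1 (is_deriveB (is_derive_id t 1)
    (is_deriveZ c (is_deriveV tn0 (is_derive_id t 1)))).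
  have -> : (fun t => (t - c / t) / 2) = 2^-1 \*: (id - c \*: (fun y => y^-1)).
    by apply/funext => y; rewrite mulrC.
  apply: is_derive_eq dF _.
  change (2^-1 * (1 - c * (- t ^- 2 * 1)) = (1 + c / t ^+ 2) / 2).
  by rewrite mulr1 mulrN opprK mulrC.
- move=> t t0; have tn0 : t != 0 by rewrite gt_eqF.
  apply: cvgM; last exact: cvg_cst.
  apply: cvgD; first exact: cvg_cst.
  apply: cvgM; first exact: cvg_cst.
  apply: cvgV; first by rewrite expf_neq0.
  exact: exprn_continuous.
- move=> y _.
  have yc0 : 0 < y ^+ 2 + c by rewrite ltr_wpDl// sqr_ge0.
  have lt : `|y| < Num.sqrt (y ^+ 2 + c) by rewrite -sqrtr_sqr ltr_sqrt// ltrDl.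
  have g0 : 0 < y + Num.sqrt (y ^+ 2 + c).
    by rewrite -ltrBlDl sub0r (le_lt_trans _ lt)// -normrN ler_norm.
  split => //.
  have := sqr_sqrtr (ltW yc0); move: (Num.sqrt _) g0 => r g0 rE.
  apply: (mulIf (lt0r_neq0 g0)).
  rewrite (_ : c = r ^+ 2 - y ^+ 2); last by rewrite rE; ring.
  by field; rewrite gt_eqF.
- by move=> y _; exact: cG.
Qed.

(** Under x = b tan theta with [a] and [b] positive, the integral over the line becomes twice that
    of 1 / sqrt (a^2 cos^2 theta + b^2 sin^2 theta) from 0 to pi/2, a complete elliptic integral. *)
Definition agm_fun a b x := (Num.sqrt ((x ^+ 2 + a ^+ 2) * (x ^+ 2 + b ^+ 2)))^-1.

Definition agm_int a b := (\int[mu]_x (agm_fun a b x)%:E)%E.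

Lemma agm_fun_ge0 a b x : 0 <= agm_fun a b x.
Proof. by rewrite invr_ge0 sqrtr_ge0. Qed.

Lemma sqrD_gt0 a x : 0 < a -> 0 < x ^+ 2 + a ^+ 2.
Proof. by move=> a0; rewrite ltr_wpDl ?sqr_ge0// exprn_gt0. Qed.

Lemma continuous_agm_fun a b : 0 < a -> 0 < b -> continuous (agm_fun a b).
Proof.
move=> a0 b0 x; apply: cvgV.
  by rewrite gt_eqF// sqrtr_gt0 mulr_gt0// sqrD_gt0.
have cp (c : R) : (t ^+ 2 + c @[t --> x] --> x ^+ 2 + c)%R.
  by apply: cvgD; [exact: exprn_continuous|exact: cvg_cst].
apply: continuous_cvg; first exact: sqrt_continuous.
by apply: cvgM; exact: cp.
Qed.

Lemma agm_int_half a b : 0 < a -> 0 < b ->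
  (agm_int a b = 2%:E * \int[mu]_(x in `]0%R, +oo[) (agm_fun a b x)%:E)%E.
Proof.
move=> a0 b0; apply: ge0_even_integralT.
- exact: agm_fun_ge0.
- exact: continuous_agm_fun.
- by move=> x; rewrite /agm_fun sqrrN.
Qed.

Lemma agm_int_double a b : 0 < a -> 0 < b ->
  (agm_int a b = \int[mu]_(x in `]0%R, +oo[) (2 * agm_fun a b x)%:E)%E.
Proof.
move=> a0 b0; rewrite agm_int_half//.
under [RHS]eq_integral do rewrite EFinM.
rewrite ge0_integralZl_EFin//.
- by move=> x _; rewrite lee_fin agm_fun_ge0.
- apply/measurable_EFinP/measurable_funTS.
  by apply: continuous_measurable_fun; exact: continuous_agm_fun.
Qed.

Lemma sqrtr_of_sqr (x y : R) : 0 <= y -> x = y ^+ 2 -> Num.sqrt x = y.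
Proof. by move=> y0 ->; rewrite sqrtr_sqr ger0_norm. Qed.

(* Gauss's invariance, by [x = (t - ab/t) / 2]. *)
Lemma agm_int_step a b b1 : 0 < a -> 0 < b -> 0 < b1 -> b1 ^+ 2 = a * b ->
  agm_int ((a + b) / 2) b1 = agm_int a b.
Proof.
move=> a0 b0 b10 b1E; have ab0 : 0 < a * b by rewrite mulr_gt0.
have m0 : 0 < (a + b) / 2 by rewrite divr_gt0// addr_gt0.
rewrite [RHS]agm_int_double// /agm_int (ge0_integral_landen (a * b))//.
- apply: eq_integral => t /[!inE]/=; rewrite in_itv/= andbT => t0; congr EFin.
  have p0 : 0 < (t ^+ 2 + a ^+ 2) * (t ^+ 2 + b ^+ 2) by rewrite mulr_gt0// sqrD_gt0.
  rewrite /agm_fun; have := sqr_sqrtr (ltW p0).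
  have : 0 < Num.sqrt ((t ^+ 2 + a ^+ 2) * (t ^+ 2 + b ^+ 2)) by rewrite sqrtr_gt0.
  move: (Num.sqrt _) => s s0 sE.
  (* For x = (t - ab/t) / 2 one has x^2 + ((a + b)/2)^2 = (t^2 + a^2)(t^2 + b^2) / (2t)^2 and x^2 +
     ab = ((t + ab/t)/2)^2; the last root cancels against the Jacobian. *)
  have -> : Num.sqrt ((((t - a * b / t) / 2) ^+ 2 + ((a + b) / 2) ^+ 2) *
      (((t - a * b / t) / 2) ^+ 2 + b1 ^+ 2)) =
      s / (2 * t) * ((t + a * b / t) / 2).
    apply: sqrtr_of_sqr.
      by rewrite mulr_ge0// ltW// divr_gt0// ?mulr_gt0// addr_gt0// divr_gt0.
    rewrite b1E [RHS]exprMn (expr_div_n s) sE.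
    by field; rewrite gt_eqF.
  field; rewrite !gt_eqF//= ?addr_gt0 ?mulr_gt0//.
- exact: continuous_agm_fun.
- exact: agm_fun_ge0.
Qed.

(** For x = (t - 1/t) / 2, x^2 + 1 is the square of (t + 1/t) / 2 and x^2 + 1/2 = (1 + t^4) /
    (2t)^2. *)
Lemma agm_int_lemniscatic :
  (agm_int 1 (Num.sqrt 2)^-1 =
   \int[mu]_(u in `]0%R, +oo[) (2 * (Num.sqrt (1 + u ^+ 4))^-1)%:E)%E.
Proof.
have r2 : 0 < Num.sqrt (2 : R) by rewrite sqrtr_gt0.
have r2E : ((Num.sqrt (2 : R))^-1) ^+ 2 = 2^-1 by rewrite exprVn sqr_sqrtr.
rewrite /agm_int (ge0_integral_landen 1)//.
- apply: eq_integral => t /[!inE]/=; rewrite in_itv/= andbT => t0; congr EFin.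
  have p0 : 0 < 1 + t ^+ 4 by rewrite ltr_wpDr// exprn_ge0// ltW.
  rewrite /agm_fun; have := sqr_sqrtr (ltW p0).
  have : 0 < Num.sqrt (1 + t ^+ 4) by rewrite sqrtr_gt0.
  move: (Num.sqrt (1 + t ^+ 4)) => s s0 sE.
  have -> : Num.sqrt ((((t - 1 / t) / 2) ^+ 2 + 1 ^+ 2) *
      (((t - 1 / t) / 2) ^+ 2 + ((Num.sqrt 2)^-1) ^+ 2)) =
      s / (2 * t) * ((t + 1 / t) / 2).
    apply: sqrtr_of_sqr.
      by rewrite mulr_ge0// ltW// divr_gt0// ?mulr_gt0// addr_gt0// divr_gt0.
    rewrite r2E [RHS]exprMn (expr_div_n s) sE.
    by field; rewrite gt_eqF.
  field; rewrite !gt_eqF//= ?addr_gt0 ?mulr_gt0//.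
- by apply: continuous_agm_fun; rewrite ?invr_gt0.
- exact: agm_fun_ge0.
Qed.

Lemma agm_int_diag m : 0 < m -> agm_int m m = (pi / m)%:E.
Proof.
move=> m0; have mn0 : m != 0 by rewrite gt_eqF.
have fE x : agm_fun m m x = (x ^+ 2 + m ^+ 2)^-1.
  by rewrite /agm_fun -expr2 sqrtr_sqr gtr0_norm// sqrD_gt0.
have cf := continuous_agm_fun m m m0 m0.
have dF x : is_derive x 1 (fun x => m^-1 * atan (m^-1 * x)) (agm_fun m m x).
  rewrite fE (_ : (x ^+ 2 + m ^+ 2)^-1 = m^-1 * ((1 + (m^-1 * x) ^+ 2)^-1 * (m^-1 * 1))).
    by apply: is_deriveZ; apply: is_derive1_comp; exact: is_deriveZ.
  by field; rewrite mn0 addrC gt_eqF// sqrD_gt0.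
rewrite agm_int_half// integral_itv_obnd_cbnd; last first.
  by apply/measurable_EFinP/measurable_funTS; exact: continuous_measurable_fun.
rewrite (@ge0_continuous_FTC2y _ _ (fun x => m^-1 * atan (m^-1 * x)) 0 (m^-1 * (pi / 2))).
- by rewrite mulr0 atan0 mulr0 sube0 -EFinM; congr EFin; field.
- by move=> x _; exact: agm_fun_ge0.
- exact: continuous_subspaceT.
- apply: cvgM; first exact: cvg_cst.
  apply: (cvg_comp _ _ _ (@cvgy_atan R)).
  by apply: gt0_cvgMry; [rewrite invr_gt0 | exact: cvg_id].
- by move=> x _; have [] := dF x.
- apply: cvg_at_right_filter.
  have : {for 0, continuous (fun x => m^-1 * atan (m^-1 * x))}.
    apply/differentiable_continuous/derivable1_diffP.
    by have [] := dF 0.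
  exact.
- by move=> x _; rewrite derive1E; have [_ ->] := dF x.
Qed.

Lemma agm_int_le a b a' b' : 0 < a -> 0 < b -> a <= a' -> b <= b' ->
  (agm_int a' b' <= agm_int a b)%E.
Proof.
move=> a0 b0 aa' bb'.
have a'0 : 0 < a' := lt_le_trans a0 aa'; have b'0 : 0 < b' := lt_le_trans b0 bb'.
have mf (c d : R) : 0 < c -> 0 < d -> measurable_fun [set: R] (EFin \o agm_fun c d).
  move=> c0 d0; apply/measurable_EFinP.
  by apply: continuous_measurable_fun; exact: continuous_agm_fun.
apply: ge0_le_integral => //.
- by move=> x _; rewrite lee_fin agm_fun_ge0.
- exact: (mf a' b').
- exact: (mf a b).
move=> x _; rewrite lee_fin lef_pV2 ?posrE ?sqrtr_gt0 ?mulr_gt0 ?sqrD_gt0//.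
rewrite ler_sqrt; last by rewrite mulr_ge0// ltW// sqrD_gt0.
have sq_le (c c' : R) : 0 < c -> 0 < c' -> c <= c' -> x ^+ 2 + c ^+ 2 <= x ^+ 2 + c' ^+ 2.
  by move=> c0 c'0 cc'; rewrite lerD2l ler_pXn2r// nnegrE ltW.
apply: ler_pM; [exact/ltW/sqrD_gt0|exact/ltW/sqrD_gt0|exact: sq_le|exact: sq_le].
Qed.

(** By [agm_int_step] the integral is constant along the iteration; by monotonicity it lies between
    the diagonal values pi / a_n and pi / b_n, which share the limit pi / m. No limit is taken under
    the integral sign. *)
Lemma agm_int_lim (a b : nat -> R) m : agm_seq a b -> 0 < m ->
  a @ \oo --> m -> agm_int (a 0%N) (b 0%N) = (pi / m)%:E.
Proof.
move=> ab m0 am; have bm := agm_seq_cvg _ _ _ ab am.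
have constI n : agm_int (a n) (b n) = agm_int (a 0%N) (b 0%N).
  elim: n => // n IHn; have [an bn aE bE] := ab n; have [_ bn1 _ _] := ab n.+1.
  by rewrite -IHn aE agm_int_step.
(* The starting values may come in either order, so the inequality of the means is used only from
   index 1 on. *)
have le_ba n : b n.+1 <= a n.+1.
  have [an bn aE bE] := ab n; have [an1 bn1 _ _] := ab n.+1.
  rewrite -(ler_pXn2r (n := 2)) ?nnegrE ?(ltW an1) ?(ltW bn1)//.
  rewrite bE aE -subr_ge0.
  rewrite (_ : _ - _ = ((a n - b n) / 2) ^+ 2); last by field.
  exact: sqr_ge0.
have leI n : ((pi / a n.+1)%:E <= agm_int (a 0%N) (b 0%N) <= (pi / b n.+1)%:E)%E.
  have [an bn _ _] := ab n.+1; rewrite -(constI n.+1) -!agm_int_diag//.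
  by rewrite !agm_int_le.
have Ifin : agm_int (a 0%N) (b 0%N) \is a fin_num.
  have /andP[lo hi] := leI 0%N.
  by rewrite fin_numE; apply/andP; split; apply/eqP => E; rewrite E in lo hi.
move: leI; rewrite -(fineK Ifin); move: (fine _) => r leI; congr EFin.
have lim_inv (c : nat -> R) : c @ \oo --> m -> pi / c n.+1 @[n --> \oo] --> pi / m.
  move=> cm; apply: cvgM; first exact: cvg_cst.
  by apply: cvgV; [rewrite gt_eqF | rewrite (cvg_shiftS c)].
apply/eqP; rewrite eq_le; apply/andP; split.
- apply: (ler_cvg_to (cvg_cst r) (lim_inv _ bm)); apply: nearW => n.
  by have /andP[] := leI n.
- apply: (ler_cvg_to (lim_inv _ am) (cvg_cst r)); apply: nearW => n.
  by have /andP[] := leI n.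
Qed.

(** Divided by A(pi), the ascending iteration at pi starts at 1 and 1/sqrt 2, by self-duality and
    [sech_sum_pi_sqrt2], and tends to 1/A(pi). *)
Lemma sech_sum_pi_integral :
  (\int[mu]_(u in `]0%R, +oo[) (2 * (Num.sqrt (1 + u ^+ 4))^-1)%:E =
   (pi * sech_sum pi)%:E)%E.
Proof.
rewrite -agm_int_lemniscatic.
have pi0 := pi_gt0 R.
have A0 : 0 < @sech_sum R pi by rewrite (lt_le_trans ltr01)// sech_sum_ge1.
have r2 : 0 < Num.sqrt (2 : R) by rewrite sqrtr_gt0.
have := agm_int_lim _ _ (sech_sum pi)^-1 (agm_seq_scale _ _ _ A0 (agm_seq_up pi pi0)).
rewrite expr0 mul1r expr1 invrK -sech_sum_pi_selfdual divff ?gt_eqF//.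
have -> : (sech_sum (pi / 2) - sech_sum pi) / sech_sum pi = (Num.sqrt 2)^-1 :> R.
  have c0 : sech_sum (pi / 2) - @sech_sum R pi != 0.
    by apply: contraTneq A0 => c0; rewrite sech_sum_pi_sqrt2 c0 mulr0 ltxx.
  by rewrite [X in _ / X]sech_sum_pi_sqrt2 invfM mulrCA divff ?mulr1.
apply; first by rewrite invr_gt0.
rewrite -[X in _ --> X]mul1r; apply: cvgM; last exact: cvg_cst.
exact: cvg_sech_sum_up.
Qed.

End agm_integral.

(** * The square of Gamma(1/4) as a double integral *)

Section gamma_quarter.
Context {R : realType}.
Local Notation mu := (@lebesgue_measure R).
Local Notation D := (`]0%R, +oo[%classic : set R).

Lemma fubini_tonelli_set (h : R * R -> R) (A B : set R) :
  measurable A -> measurable B -> measurable_fun [set: R * R] h ->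
  (forall p, A p.1 -> B p.2 -> 0 <= h p) ->
  (\int[mu]_(x in A) \int[mu]_(y in B) (h (x, y))%:E =
   \int[mu]_(y in B) \int[mu]_(x in A) (h (x, y))%:E)%E.
Proof.
move=> mA mB mh h0.
(* Indicators turn the integrals over [A] and [B] into integrals over the whole line, where
   Tonelli's theorem applies. *)
pose H p := (\1_A p.1 * \1_B p.2 * h p)%:E.
have mH : measurable_fun [set: R * R] H.
  apply/measurable_EFinP; apply: measurable_funM => //.
  apply: measurable_funM.
    by apply: (measurableT_comp (measurable_indic mA)); exact: measurable_fst.
  by apply: (measurableT_comp (measurable_indic mB)); exact: measurable_snd.
have H0 p : (0 <= H p)%E.
  rewrite lee_fin /H !indicE.
  have [pA|] := boolP (p.1 \in A); last by rewrite !mul0r.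
  have [pB|] := boolP (p.2 \in B); last by rewrite mulr0 mul0r.
  by rewrite !mul1r; apply: h0; exact/set_mem.
have E1 x : (\int[mu]_y H (x, y) =
    ((fun x => \int[mu]_(y in B) (h (x, y))%:E) \_ A) x)%E.
  rewrite /H patchE /= indicE; case: ifPn => xA; last first.
    by apply: integral0_eq => y _; rewrite !mul0r.
  rewrite [RHS]integral_mkcond; apply: eq_integral => y _.
  by rewrite patchE mul1r indicE; case: ifPn => yB; rewrite ?mul1r ?mul0r.
have E2 y : (\int[mu]_x H (x, y) =
    ((fun y => \int[mu]_(x in A) (h (x, y))%:E) \_ B) y)%E.
  rewrite /H patchE /= [\1_B y]indicE; case: ifPn => yB; last first.
    by apply: integral0_eq => x _; rewrite mulr0 mul0r.
  rewrite [RHS]integral_mkcond; apply: eq_integral => x _.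
  by rewrite patchE mulr1 indicE; case: ifPn => xA; rewrite ?mul1r ?mul0r.
rewrite integral_mkcond [RHS]integral_mkcond.
transitivity (\int[mu]_x \int[mu]_y H (x, y))%E.
  by apply: eq_integral => x _; rewrite E1.
transitivity (\int[mu]_y \int[mu]_x H (x, y))%E.
  exact: (@fubini_tonelli _ _ _ _ _ mu mu H mH H0).
by apply: eq_integral => y _; rewrite -E2.
Qed.

Lemma is_interval_D : is_interval D.
Proof. exact: interval_is_interval. Qed.

Lemma is_derive_Xn n (x : R) : is_derive x 1 (fun x => x ^+ n) (n%:R * x ^+ n.-1).
Proof.
apply: DeriveDef; first exact: exprn_derivable.
by rewrite exp_derive /GRing.scale /= mulr1.
Qed.

Lemma expr_lt_itv n : (0 < n)%N -> {in `]0, +oo[ &, {homo (fun x : R => x ^+ n) : x y / x < y}}.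
Proof.
move=> n0 x y; rewrite !in_itv/= !andbT => x0 y0 xy.
by rewrite ltr_pXn2r// nnegrE ltW.
Qed.

Lemma powR_Xn4_quarter (x : R) : 0 < x -> (x ^+ 4) `^ (1 / 4 - 1) = x ^- 3.
Proof.
move=> x0; rewrite -powR_mulrn ?ltW// -powRrM.
rewrite (_ : 4%:R * _ = - 3%:R); last by field.
by rewrite powRN powR_mulrn// ltW.
Qed.

(** Substitution t = x^4: the factor t^(-3/4) = x^-3 cancels the x^3 of the Jacobian. *)
Lemma gamma_quarter_quartic :
  (\int[mu]_(t in D) (t `^ (1 / 4 - 1) * expR (- t))%:E =
   \int[mu]_(x in D) (4 * expR (- x ^+ 4))%:E)%E.
Proof.
transitivity (\int[mu]_(x in D)
    ((x ^+ 4) `^ (1 / 4 - 1) * expR (- x ^+ 4) * (4 * x ^+ 3))%:E)%E; last first.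
  apply: eq_integral => x /[!inE]/=; rewrite in_itv/= andbT => x0; congr EFin.
  by rewrite powR_Xn4_quarter//; field; rewrite gt_eqF.
apply: (@ge0_integration_by_substitution0y _ (fun x => x ^+ 4)
  (fun x => 4 * x ^+ 3) (fun y => Num.sqrt (Num.sqrt y))
  (fun t => t `^ (1 / 4 - 1) * expR (- t))).
- exact: is_interval_D.
- exact: expr_lt_itv.
- by move=> x _; exact: is_derive_Xn.
- by move=> x _; apply: cvgM; [exact: cvg_cst|exact: exprn_continuous].
- by move=> x x0; rewrite /= in_itv/= andbT exprn_gt0.
- move=> y; rewrite /= in_itv/= andbT => y0; rewrite !sqrtr_gt0; split => //.
  by rewrite (exprM _ 2 2) !sqr_sqrtr ?sqrtr_ge0// ltW.
- move=> y; rewrite /= in_itv/= andbT => y0.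
  have cp : {for y, continuous (fun t => t `^ (1 / 4 - 1))}.
    apply/differentiable_continuous/derivable1_diffP.
    by apply: derivable_powR; rewrite in_itv/= andbT.
  apply: cvgM; first exact: cp.
  by apply: continuous_comp; [exact: opp_continuous|exact: continuous_expR].
- by move=> y _; rewrite mulr_ge0 ?powR_ge0 ?expR_ge0.
Qed.

Lemma integral_scaleD (G : R -> R) (k : R) : 0 < k -> continuous G ->
  (forall x, 0 <= G x) ->
  (\int[mu]_(y in D) (G y)%:E = \int[mu]_(u in D) (G (k * u) * k)%:E)%E.
Proof.
move=> k0 cG G0.
apply: (@ge0_integration_by_substitution0y _ (fun u => k * u) (fun=> k) (fun y => y / k)) => //.
- exact: is_interval_D.
- by move=> x y _ _; rewrite ltr_pM2l.
- by move=> x _; rewrite -[X in is_derive _ _ _ X]mulr1; exact: is_deriveZ.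
- by move=> x _; exact: cvg_cst.
- by move=> x x0; rewrite /= in_itv/= andbT mulr_gt0.
- move=> y; rewrite /= in_itv/= andbT => y0; rewrite divr_gt0//; split => //.
  by rewrite mulrC divfK// gt_eqF.
- by move=> y _; exact: cG.
Qed.

(** Substitution w = x^2 s reduces this to 1/(2s) times the half-line Gaussian integral, sqrt pi /
    2. *)
Lemma integral_gauss_sqr (s : R) : 0 < s ->
  (\int[mu]_(x in D) (x * expR (- (x ^+ 4 * s ^+ 2)))%:E =
   (Num.sqrt pi / 4 / s)%:E)%E.
Proof.
move=> s0; have sn0 : s != 0 by rewrite gt_eqF.
transitivity (\int[mu]_(w in D) ((2 * s)^-1 * gauss_fun w)%:E)%E.
  transitivity (\int[mu]_(x in D)
      ((2 * s)^-1 * gauss_fun (x ^+ 2 * s) * (2%:R * x ^+ 1 * s))%:E)%E.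
    apply: eq_integral => x _; congr EFin.
    rewrite /gauss_fun (_ : x ^+ 4 * s ^+ 2 = (x ^+ 2 * s) ^+ 2); last by ring.
    by rewrite expr1; field.
  apply/esym; apply: (@ge0_integration_by_substitution0y _ (fun x => x ^+ 2 * s)
    (fun x => 2%:R * x ^+ 1 * s) (fun y => Num.sqrt (y / s))
    (fun w => (2 * s)^-1 * gauss_fun w)).
  - exact: is_interval_D.
  - move=> x y x0 y0 xy; rewrite ltr_pM2r//; exact: (expr_lt_itv 2).
  - move=> x _; rewrite (_ : (fun x => _) = s \*: (fun x => x ^+ 2)); last first.
      by apply/funext => y; rewrite mulrC.
    have dF := is_deriveZ s (is_derive_Xn 2 x).
    by apply: is_derive_eq dF _; rewrite /GRing.scale /= mulrC.
  - move=> x _; apply: cvgM; last exact: cvg_cst.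
    by apply: cvgM; [exact: cvg_cst|exact: cvg_id].
  - by move=> x x0; rewrite /= in_itv/= andbT mulr_gt0// exprn_gt0.
  - move=> y; rewrite /= in_itv/= andbT => y0; rewrite sqrtr_gt0 divr_gt0//.
    by split => //; rewrite sqr_sqrtr ?divfK// divr_ge0// ltW.
  - by move=> y _; apply: cvgM; [exact: cvg_cst|exact: continuous_gauss_fun].
  - by move=> y _; rewrite mulr_ge0 ?gauss_fun_ge0// invr_ge0 mulr_ge0// ltW.
under eq_integral do rewrite EFinM.
have mg (A : set R) : measurable_fun A (fun x : R => (gauss_fun x)%:E).
  by apply/measurable_EFinP/measurable_funTS; exact: measurable_gauss_fun.
have c0 : 0 <= (2 * s)^-1 by rewrite invr_ge0 mulr_ge0// ltW.
have g0 (x : R) : D x -> (0 <= (gauss_fun x)%:E)%E by rewrite lee_fin gauss_fun_ge0.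
rewrite (ge0_integralZl_EFin mu _ g0 (mg D) c0)//.
rewrite integral_itv_obnd_cbnd; last exact: mg.
by rewrite integral0y_gauss -EFinM; congr EFin; field.
Qed.

(** Gamma(1/4) = 4e with e the integral of exp(-x^4). In e^2, putting y = xu and integrating in x
    first leaves a multiple of the lemniscatic integral of [sech_sum_pi_integral]. *)
Lemma gamma_quarter_sqr : (Gamma (1 / 4) : R) ^+ 2 = 2 * pi * Num.sqrt pi * sech_sum pi.
Proof.
have cE : continuous (fun x : R => expR (- x ^+ 4)).
  move=> x; apply: (@continuous_comp _ _ _ (fun x : R => - x ^+ 4) expR).
    by apply: cvgN; exact: exprn_continuous.
  exact: continuous_expR.
have mE (A : set R) : measurable_fun A (fun x => (expR (- x ^+ 4))%:E).
  by apply/measurable_EFinP/measurable_funTS; exact: continuous_measurable_fun.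
have E0 (x : R) : D x -> (0 <= (expR (- x ^+ 4))%:E)%E by rewrite lee_fin expR_ge0.
rewrite /Gamma /Rintegral gamma_quarter_quartic.
under eq_integral do rewrite EFinM.
rewrite (ge0_integralZl_EFin mu _ E0 (mE D) (ler0n R 4))//.
set e := (\int[mu]_(x in D) (expR (- x ^+ 4))%:E)%E.
have e0 : (0 <= e)%E by apply: integral_ge0.
have ee : (e * e = (Num.sqrt pi / 8 * (pi * sech_sum pi))%:E)%E.
  transitivity (\int[mu]_(x in D) \int[mu]_(u in D)
      (x * expR (- (x ^+ 4 * (1 + u ^+ 4))))%:E)%E.
    rewrite {2}/e -(ge0_integralZl mu _ (mE D) E0 e0)//.
    apply: eq_integral => x /[!inE]/=; rewrite in_itv/= andbT => x0.
    rewrite muleC /e -(ge0_integralZl_EFin mu _ E0 (mE D) (expR_ge0 _))//.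
    under eq_integral do rewrite -EFinM -expRD.
    have cy : continuous (fun y : R => expR (- x ^+ 4 + - y ^+ 4)).
      move=> y; apply: (@continuous_comp _ _ _ (fun y : R => - x ^+ 4 + - y ^+ 4) expR).
        by apply: cvgD; [exact: cvg_cst|apply: cvgN; exact: exprn_continuous].
      exact: continuous_expR.
    (* Here y = xu; the Jacobian supplies the factor x required by [integral_gauss_sqr]. *)
    rewrite (integral_scaleD _ x x0 cy (fun y : R => expR_ge0 _)).
    apply: eq_integral => u _; congr EFin; rewrite mulrC; congr (_ * expR _); ring.
  transitivity (\int[mu]_(u in D) \int[mu]_(x in D)
      (x * expR (- (x ^+ 4 * (1 + u ^+ 4))))%:E)%E.
    apply: (fubini_tonelli_set (fun p => p.1 * expR (- (p.1 ^+ 4 * (1 + p.2 ^+ 4))))) => //.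
    - apply: measurable_funM => //.
      apply: measurableT_comp => //; apply: measurableT_comp => //.
      apply: measurable_funM; first exact: measurable_funX.
      by apply: measurable_funD => //; exact: measurable_funX.
    - move=> [x y] /=; rewrite in_itv/= andbT => x0 _.
      by rewrite mulr_ge0 ?expR_ge0// ltW.
  pose r (u : R) := 2 * (Num.sqrt (1 + u ^+ 4))^-1.
  have p0 (u : R) : 0 < 1 + u ^+ 4 by rewrite ltr_wpDr// (exprM _ 2 2) sqr_ge0.
  have s0 (u : R) : 0 < Num.sqrt (1 + u ^+ 4) by rewrite sqrtr_gt0.
  have r0 (u : R) : D u -> (0 <= (r u)%:E)%E.
    by rewrite lee_fin mulr_ge0// invr_ge0 ltW.
  have mr : measurable_fun D (fun u => (r u)%:E).
    apply/measurable_EFinP/measurable_funTS; apply: continuous_measurable_fun.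
    move=> u; apply: cvgM; first exact: cvg_cst.
    apply: cvgV; first by rewrite gt_eqF.
    apply: continuous_cvg; first exact: sqrt_continuous.
    by apply: cvgD; [exact: cvg_cst|exact: exprn_continuous].
  have c0 : 0 <= Num.sqrt pi / 8 :> R by rewrite divr_ge0// sqrtr_ge0.
  rewrite [RHS]EFinM -sech_sum_pi_integral.
  rewrite -(ge0_integralZl_EFin mu _ r0 mr c0)//.
  apply: eq_integral => u _.
  (* The inner integral is taken with s = sqrt (1 + u^4), and sqrt pi / (4s) = (sqrt pi /
     8)(2/s). *)
  rewrite -{1}(sqr_sqrtr (ltW (p0 u))) integral_gauss_sqr// -EFinM; congr EFin.
  by rewrite /r; field; rewrite gt_eqF.
(* An infinite [e] would have an infinite square, against [ee]; so [fine e] is the true value. *)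
have efin : e \is a fin_num.
  rewrite ge0_fin_numE// ltNge leye_eq; apply/negP => /eqP E.
  by move: ee; rewrite E mulyy.
move: ee; rewrite -(fineK efin) -!EFinM => -[ee] /=.
by rewrite exprMn (expr2 (fine e)) ee; field.
Qed.

End gamma_quarter.

(** * Values at pi and pi/2 in terms of Gauss' constant, and the six distributions *)

Lemma sech_sum_pi_gauss (R : realType) :
  sech_sum pi = Num.sqrt 2 * gauss R /\
  sech_sum (pi / 2) - sech_sum pi = gauss R.
Proof.
have pi0 := pi_gt0 R.
have r2 : 0 < Num.sqrt (2 : R) by rewrite sqrtr_gt0.
have rpi : 0 < Num.sqrt (pi : R) by rewrite sqrtr_gt0.
have AE : sech_sum pi = Num.sqrt 2 * gauss R.
  rewrite /gauss /lemniscate gamma_quarter_sqr sqrtrM//.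
  by move: (@sech_sum R pi) (@pi R) pi0 rpi => A p p0 rp; field; rewrite !gt_eqF.
split => //; apply: (mulfI (lt0r_neq0 r2)).
by rewrite -sech_sum_pi_sqrt2.
Qed.

Lemma is_pmfZ (R : realType) (I : countType) (f : I -> R) (c s : R) :
  0 < s -> (forall i, 0 <= f i) -> (\esum_(i in [set: I]) (f i)%:E = s%:E)%E ->
  c = s^-1 -> is_pmf (fun i => c * f i).
Proof.
move=> s0 f0 fs ->; split; first by move=> i; rewrite mulr_ge0// invr_ge0 ltW.
under eq_esum do rewrite EFinM.
by rewrite esumZl ?invr_gt0// fs -EFinM mulVf// gt_eqF.
Qed.

Theorem theorem2p1 (R : realType) :
  let G : R := gauss R in
  let rt2 : R := Num.sqrt 2 in
  is_pmf (fun n : nat => 2 / (rt2 * G + 1) * sech (pi * n%:R)) /\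
  is_pmf (fun k : int => 1 / (rt2 * G) * sech (pi * k%:~R)) /\
  is_pmf (fun n : nat => 2 / G * sech (pi / 2 * (2 * n%:R + 1))) /\
  is_pmf (fun k : int => 1 / G * sech (pi / 2 * (2 * k%:~R + 1))) /\
  is_pmf (fun n : nat => 2 / ((1 + rt2) * G + 1) * sech (pi / 2 * n%:R)) /\
  is_pmf (fun k : int => 1 / ((1 + rt2) * G) * sech (pi / 2 * k%:~R)).
Proof.
move=> G rt2.
have pi0 := pi_gt0 R.
have pi20 : 0 < (pi : R) / 2 by rewrite divr_gt0.
have sech_ge0 (x : R) : 0 <= sech x by rewrite ltW// sech_gt0.
have rt20 : 0 < rt2 by rewrite sqrtr_gt0.
have [AE CE] := sech_sum_pi_gauss R; rewrite -/G -/rt2 in AE CE.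
have G0 : 0 < G.
  by rewrite -(pmulr_rgt0 _ rt20) -AE (lt_le_trans ltr01)// sech_sum_ge1.
(* A(pi/2) is A(pi) = sqrt 2 G plus the half-integer part A(pi/2) - A(pi) = G. *)
have A2E : sech_sum (pi / 2) = (1 + rt2) * G.
  by rewrite [RHS]mulrDl mul1r -AE -CE subrK.
have dbl : 2 * (pi / 2) = pi :> R by field.
have rG0 : 0 < rt2 * G by rewrite mulr_gt0.
have r1G0 : 0 < (1 + rt2) * G by rewrite mulr_gt0// addr_gt0.
(* The masses over Z are A(h), or A(h) - A(2h) for odd multiples. By evenness those over the
   naturals are (A(h) + 1) / 2, the index 0 being counted once, or half of the odd sum. *)
split; [|split; [|split; [|split; [|split]]]].
- apply: (@is_pmfZ _ _ _ _ ((rt2 * G + 1) / 2)) => //.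
  + by rewrite divr_gt0// addr_gt0.
  + by rewrite -AE esum_sech_nat.
  + by rewrite [RHS]invf_div.
- apply: (@is_pmfZ _ _ _ _ (rt2 * G)) => //; last by rewrite div1r.
  by rewrite -AE sech_sumE.
- apply: (@is_pmfZ _ _ _ _ (G / 2)) => //; first by rewrite divr_gt0.
  + by rewrite esum_sech_odd_nat// dbl CE.
  + by rewrite [RHS]invf_div.
- apply: (@is_pmfZ _ _ _ _ G) => //; last by rewrite div1r.
  by rewrite esum_sech_odd// dbl CE.
- apply: (@is_pmfZ _ _ _ _ (((1 + rt2) * G + 1) / 2)) => //.
  + by rewrite divr_gt0// addr_gt0.
  + by rewrite -A2E esum_sech_nat.
  + by rewrite [RHS]invf_div.
- apply: (@is_pmfZ _ _ _ _ ((1 + rt2) * G)) => //; last by rewrite div1r.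
  by rewrite -A2E sech_sumE.
Qed.
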